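(* Let $M$ be a smooth manifold, $(V,\partial)$ a cochain complex, and $\alpha=\alpha^1+\alpha^2+\alpha^3+\cdots$ a superconnection on $M$ with values in $(V,\partial)$ which is flat. Then the pair $\mathsf{T}_{\le2}(\alpha)=(A,B)$, $A:=\alpha^1$, $B:=-\pi\circ\alpha^2$, is a flat local $2$-connection on $M$ with values in the differential Lie crossed module $\mathsf{gl}(V)$.
   Context: A cochain complex $(V,\partial)$ is a finite-dimensional $\mathbb{Z}$-graded real vector space with a differential of degree $+1$. $\mathrm{End}^k(V)$ is the space of degree $k$ linear endomorphisms; for $\varphi\in\mathrm{End}^k(V)$, $[\partial,\varphi]=\partial\varphi-(-1)^k\varphi\partial$. **Flat superconnections.** On $\Omega(M)\otimes\mathrm{End}(V)$ use the product $(\omega\otimes\varphi)\circ(\eta\otimes\psi)=(-1)^{|\varphi||\eta|}(\omega\wedge\eta)\otimes\varphi\psi$. A superconnection on $M$ with values in $(V,\partial)$ is a form $\alpha=\alpha^1+\alpha^2+\cdots$ with $\alpha^i\in\Omega^i(M)\otimes\mathrm{End}^{1-i}(V)$, corresponding to the operator $D=\partial+d+\alpha$ on $\Omega(M)\otimes V$, where $\partial(\omega\otimes v)=(-1)^{|\omega|}\omega\otimes\partial v$, $d(\omega\otimes v)=d\omega\otimes v$, $(\omega\otimes\varphi)(\eta\otimes v)=(-1)^{|\varphi||\eta|}\omega\wedge\eta\otimes\varphi v$. It is flat if $D^2=0$; equivalently $[\partial,\alpha^n]+d\alpha^{n-1}+\sum_{i+j=n}\alpha^i\circ\alpha^j=0$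 for all $n\ge1$, where $[\partial,\omega\otimes\varphi]=(-1)^{|\omega|}\omega\otimes[\partial,\varphi]$. **The differential Lie crossed module $\mathsf{gl}(V)=(\delta:\mathsf{gl}^{-1}(V)\to\mathsf{gl}^0(V))$.** $\mathsf{gl}^0(V)$ is the Lie algebra (commutator bracket) of degree $0$ cochain maps $V\to V$; $\mathsf{gl}^{-1}(V)=\mathrm{End}^{-1}(V)/[\partial,\mathrm{End}^{-2}(V)]$ with bracket $[s,t]=s\partial t-t\partial s+st\partial-ts\partial$; $\delta(s)=\partial s+s\partial$; $\mathsf{gl}^0(V)$ acts on $\mathsf{gl}^{-1}(V)$ by $\phi\rhd s=\phi s-s\phi$. $\pi:\mathrm{End}^{-1}(V)\to\mathsf{gl}^{-1}(V)$ is the projection. **Local 2-connections.** A local $2$-connection on $M$ with values in a differential Lie crossed module $\delta:\mathfrak e\to\mathfrak g$ is a pair $(A,B)$, $A\in\Omega^1(M,\mathfrak g)$, $B\in\Omega^2(M,\mathfrak e)$, with $\delta B=dA+\frac12[A,A]$. It is flat if $dB+A\wedge^\rhd B=0$ in $\Omega^3(M,\mathfrak e)$, where $(\omega\otimes X)\wedge^\rhd(\eta\otimes v)=(\omega\wedge\eta)\otimes(X\rhd v)$. *)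

(* Defs.v *)
From HB Require Import structures.
From mathcomp Require Import all_boot all_order all_algebra perm.
From mathcomp Require Import all_classical all_reals all_analysis.
From mathcomp Require Import ring lra.

Set Implicit Arguments.
Unset Strict Implicit.
Unset Printing Implicit Defensive.

Import Order.TTheory GRing.Theory Num.Theory.
Import numFieldNormedType.Exports.

Local Open Scope classical_set_scope.
Local Open Scope ring_scope.
Local Open Scope quotient_scope.

Section LinearAlgebra.
Context {K : fieldType}.
Implicit Types vT : vectType K.

Lemma subspace_exists vT (S : set vT) : S 0 ->
  (forall a u v, S u -> S v -> S (a *: u + v)) ->
  exists U : {vspace vT}, forall v, v \in U <-> S v.
Proof.
move=> S0 SP.
pose P d := `[< exists U : {vspace vT}, \dim U = d /\ forall v, v \in U -> S v >].
have exP : exists d, P d.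
  by exists 0%N; apply/asboolP; exists 0%VS; split;
     [rewrite dimv0 | move=> v; rewrite memv0 => /eqP ->].
have bP d : P d -> (d <= \dim {:vT})%N.
  by move=> /asboolP[U [<- _]]; apply: dimvS; apply: subvf.
case: (ex_maxnP exP bP) => d /asboolP[U [dU US]] dmax.
exists U => v; split; first exact: US.
move=> Sv; apply: contrapT => /negP vU.
have : P (\dim (<[v]> + U)%VS).
  apply/asboolP; exists (<[v]> + U)%VS; split=> // w /memv_addP[u + [t tU ->]].
  by move=> /vlineP[a ->]; apply: SP => //; apply: US.
move=> /dmax; rewrite -dU leqNgt => /negP; apply.
rewrite ltnNge; apply: contra vU => le.
have sU : (U <= <[v]> + U)%VS by apply: addvSr.
have /eqP -> : U == (<[v]> + U)%VS by rewrite eqEdim sU.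
by apply: (subvP (addvSl _ _)); apply: memv_line.
Qed.

(* The subspace with underlying set S; junk value when S is not a subspace,
   see subspace_ofP. *)
Definition subspace_of vT (S : set vT) : {vspace vT} :=
  xget 0%VS [set U : {vspace vT} | forall v, v \in U <-> S v].

Lemma subspace_ofP vT (S : set vT) : S 0 ->
  (forall a u v, S u -> S v -> S (a *: u + v)) ->
  forall v, v \in subspace_of S <-> S v.
Proof.
move=> S0 SP; rewrite /subspace_of.
by case: xgetP => [U _ //|no]; case: (subspace_exists S0 SP) => U /no.
Qed.

Definition quotv vT (U : {vspace vT}) : Type := Quotient.quot (pred_of_vspace U).

HB.instance Definition _ vT (U : {vspace vT}) :=
  EqQuotient.on (quotv U).
HB.instance Definition _ vT (U : {vspace vT}) := Choice.on (quotv U).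
HB.instance Definition _ vT (U : {vspace vT}) := GRing.Zmodule.on (quotv U).

Section Quot.
Context {vT : vectType K} (U : {vspace vT}).

Definition qproj (v : vT) : quotv U := \pi_(quotv U) v.

Lemma qprojE u v : (qproj u = qproj v) <-> (u - v \in U).
Proof. by rewrite (Quotient.idealrBE (pred_of_vspace U)); split => /eqP. Qed.

Lemma qproj_surj (x : quotv U) : qproj (repr x) = x.
Proof. exact: reprK. Qed.

Lemma qproj_repr v : repr (qproj v) - v \in U.
Proof. by apply/qprojE; rewrite qproj_surj. Qed.

Lemma qprojD u v : qproj (u + v) = qproj u + qproj v.
Proof. exact: (Quotient.pi_add (pred_of_vspace U)). Qed.

Definition qscale (a : K) (x : quotv U) : quotv U := qproj (a *: repr x).

Lemma qscaleE a v : qscale a (qproj v) = qproj (a *: v).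
Proof. by apply/qprojE; rewrite -scalerBr rpredZ// qproj_repr. Qed.

Lemma qscaleA a b x : qscale a (qscale b x) = qscale (a * b) x.
Proof. by rewrite -[x]qproj_surj !qscaleE scalerA. Qed.
Lemma qscale1 : left_id 1 qscale.
Proof. by move=> x; rewrite -[x]qproj_surj !qscaleE scale1r. Qed.
Lemma qscaleDr : right_distributive qscale +%R.
Proof.
move=> a x y; rewrite -[x]qproj_surj -[y]qproj_surj.
by rewrite !(qscaleE, =^~ qprojD) scalerDr.
Qed.
Lemma qscaleDl x : {morph qscale^~ x : a b / a + b}.
Proof.
by move=> a b; rewrite -[x]qproj_surj !(qscaleE, =^~ qprojD) scalerDl.
Qed.

HB.instance Definition _ := GRing.Zmodule_isLmodule.Build K (quotv U)
  qscaleA qscale1 qscaleDr qscaleDl.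

Lemma qprojZ a v : qproj (a *: v) = a *: qproj v.
Proof. exact/esym/qscaleE. Qed.

Lemma qproj_is_linear : linear qproj.
Proof. by move=> a u v; rewrite qprojD qprojZ. Qed.

HB.instance Definition _ := GRing.isLinear.Build K vT (quotv U) _ qproj
  qproj_is_linear.

Lemma quotv_vect_iso : Vector.axiom (\dim (U^C)%VS) (quotv U).
Proof.
have dx : (U^C :&: U = 0)%VS by rewrite capvC capv_compl.
pose W := (U^C)%VS.
pose p := daddv_pi W U.
have pU v : (p v == 0) = (v \in U).
  have : v \in (W + U)%VS by rewrite addvC addv_complf memvf.
  move=> /(daddv_pi_add dx); rewrite -/p => vE.
  apply/eqP/idP => [p0|vU]; first by rewrite -vE p0 add0r memv_pi.
  have := vE; rewrite (daddv_pi_id _ vU) 1?capvC //.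
  by move=> /(canRL (addrK _)); rewrite subrr.
exists (fun x => \row_i coord (vbasis W) i (p (repr x))).
  move=> a x y; apply/rowP=> i; rewrite !mxE.
  have -> : p (repr (a *: x + y)) = a *: p (repr x) + p (repr y).
    apply/eqP; rewrite -subr_eq0 -linearP -linearB pU.
    by apply/qprojE; rewrite linearP /= !qproj_surj.
  by rewrite linearP.
exists (fun rw : 'rV_(\dim W) => qproj (\sum_i rw 0 i *: (vbasis W)`_i)).
  move=> x; rewrite -[RHS]qproj_surj; apply/qprojE.
  under eq_bigr do rewrite mxE.
  rewrite -coord_vbasis ?memv_pi // -pU linearB /= subr_eq0.
  by rewrite (daddv_pi_id dx) ?memv_pi.
move=> rw; apply/rowP=> i; rewrite mxE.
set w := \sum_i _.
have wW : w \in W.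
  by apply: rpred_sum => j _; rewrite rpredZ ?vbasis_mem ?memt_nth.
have -> : p (repr (qproj w)) = w.
  rewrite -[RHS](daddv_pi_id dx wW); apply/eqP.
  by rewrite -subr_eq0 -linearB pU qproj_repr.
by rewrite /w coord_sum_free ?(basis_free (vbasisP W)).
Qed.

HB.instance Definition _ := Lmodule_hasFinDim.Build K (quotv U) quotv_vect_iso.

End Quot.
End LinearAlgebra.

Record cochainComplex (R : realType) := CochainComplex {
  cc_space :> vectType R;
  cc_gr : int -> {vspace cc_space};
  cc_decomp : exists2 s : seq int, uniq s &
    [/\ forall k, k \notin s -> cc_gr k = 0%VS,
        (\sum_(k <- s) cc_gr k)%VS = fullv &
        directv (\sum_(k <- s) cc_gr k)%VS];
  cc_d : 'End(cc_space);
  cc_d_deg : forall k v, v \in cc_gr k -> cc_d v \in cc_gr (k + 1);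
  cc_dd : (cc_d \o cc_d)%VF = 0
}.

Definition bilinear_fun (R : realType) (U W Z : lmodType R) (b : U -> W -> Z) :=
  (forall w, linear (b^~ w)) /\ (forall u, linear (b u)).

Record lieAlg (R : realType) := LieAlg {
  lie_space :> vectType R;
  lie : lie_space -> lie_space -> lie_space;
  lie_bilinear : bilinear_fun lie;
  liexx : forall x, lie x x = 0;
  lie_jacobi : forall x y z, lie x (lie y z) = lie (lie x y) z + lie y (lie x z)
}.

Record lieCrossedModule (R : realType) := LieCrossedModule {
  cm_g : lieAlg R;
  cm_e : lieAlg R;
  cm_delta : cm_e -> cm_g;
  cm_act : cm_g -> cm_e -> cm_e;
  cm_delta_linear : linear cm_delta;
  cm_delta_lie : forall u v, cm_delta (lie u v) = lie (cm_delta u) (cm_delta v);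
  cm_act_bilinear : bilinear_fun cm_act;
  cm_act_lie : forall x y u,
    cm_act (lie x y) u = cm_act x (cm_act y u) - cm_act y (cm_act x u);
  cm_act_der : forall x u v,
    cm_act x (lie u v) = lie (cm_act x u) v + lie u (cm_act x v);
  cm_equivariance : forall x u, cm_delta (cm_act x u) = lie x (cm_delta u);
  cm_peiffer : forall u v, cm_act (cm_delta u) v = lie u v
}.

Lemma scalar_ext (K : fieldType) (vT : vectType K) (x y : vT) :
  (forall l : {scalar vT}, l x = l y) -> x = y.
Proof.
move=> xy; rewrite (coord_vbasis (memvf x)) (coord_vbasis (memvf y)).
by apply: eq_bigr => i _; rewrite xy.
Qed.

Section EndV.
Context {R : realType} (V : cochainComplex R).
Local Notation d := (cc_d V).
Implicit Types (k l : int) (f g h : 'End(V)).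

(* gEnd k is End^k(V), see gEndP *)
Definition gEnd k : {vspace 'End(V)} := subspace_of
  [set f : 'End(V) | forall i v, v \in cc_gr V i -> f v \in cc_gr V (i + k)].

Lemma gEndP k f : f \in gEnd k <->
  forall i v, v \in cc_gr V i -> f v \in cc_gr V (i + k).
Proof.
rewrite subspace_ofP //= => [i v _|a f' g Sf Sg i v vi].
  by rewrite lfunE /= mem0v.
by rewrite add_lfunE scale_lfunE rpredD ?rpredZ ?Sf ?Sg.
Qed.

Lemma gEnd_comp k l f g : f \in gEnd k -> g \in gEnd l ->
  (f \o g)%VF \in gEnd (k + l).
Proof.
move=> /gEndP fk /gEndP gl; apply/gEndP => i v vi.
by rewrite comp_lfunE (addrC k) addrA fk// gl.
Qed.

Lemma gEnd_d : d \in gEnd 1.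
Proof. by apply/gEndP => i v; exact: cc_d_deg. Qed.

Lemma dd0 v : d (d v) = 0.
Proof. by have /lfunP/(_ v) := cc_dd V; rewrite comp_lfunE lfunE. Qed.

(* The graded commutator [d, f] for f of degree k *)
Definition gcomm k f : 'End(V) := (d \o f)%VF - ((-1) ^ k) *: (f \o d)%VF.

Lemma gcomm_linear k : linear (gcomm k).
Proof.
move=> a f g; rewrite /gcomm comp_lfunDr comp_lfunDl -comp_lfunZr -comp_lfunZl.
by rewrite scalerBr scalerDr opprD addrACA !scalerA mulrC.
Qed.

HB.instance Definition _ k := GRing.isLinear.Build R 'End(V) 'End(V) _
  (gcomm k) (gcomm_linear k).

Definition gl0_space : {vspace 'End(V)} :=
  subspace_of [set f | f \in gEnd 0 /\ (d \o f)%VF = (f \o d)%VF].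

Lemma gl0_spaceP f : f \in gl0_space <->
  f \in gEnd 0 /\ (d \o f)%VF = (f \o d)%VF.
Proof.
rewrite subspace_ofP //= => [|a f' g [f0 fd] [g0 gd]].
  by rewrite mem0v comp_lfun0l comp_lfun0r.
split; first by rewrite rpredD ?rpredZ.
by rewrite comp_lfunDr comp_lfunDl -comp_lfunZr -comp_lfunZl fd gd.
Qed.

(* [d, End^{-2}(V)] as a subspace of End^{-1}(V) *)
Definition gEnd_exact : {vspace subvs_of (gEnd (-1))} := subspace_of
  [set s | exists2 h, h \in gEnd (-2) & vsval s = gcomm (-2) h].

Lemma gEnd_exactP (s : subvs_of (gEnd (-1))) : s \in gEnd_exact <->
  exists2 h, h \in gEnd (-2) & vsval s = gcomm (-2) h.
Proof.
rewrite subspace_ofP //= => [|a u v [h hE uE] [h' hE' vE]].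
  by exists 0; rewrite ?mem0v ?linear0.
by exists (a *: h + h'); rewrite ?rpredD ?rpredZ// !linearP /= uE vE.
Qed.


Local Notation E1 := (subvs_of (gEnd (-1))).
Local Notation gl0 := (subvs_of gl0_space).
Local Notation gl1 := (quotv gEnd_exact).

Implicit Types (s t : E1).

Definition gl_pi (s : E1) : gl1 := qproj gEnd_exact s.

Let d_comm (f : gl0) v : d (vsval f v) = vsval f (d v).
Proof.
by have /gl0_spaceP[_ /lfunP/(_ v)] := subvsP f; rewrite !comp_lfunE.
Qed.

Lemma gcomm2E h v : gcomm (-2) h v = d (h v) - h (d v).
Proof.
have e : (-1 : R) ^ (-2) = 1.
  by rewrite (_ : (-1) ^ (-2) = ((-1) ^+ 2)^-1 :> R)// sqrrN expr1n invr1.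
by rewrite /gcomm add_lfunE opp_lfunE scale_lfunE !comp_lfunE e scale1r.
Qed.

Fact gl0_lie_subproof (f g : gl0) :
  ((vsval f \o vsval g) - (vsval g \o vsval f))%VF \in gl0_space.
Proof.
have [[f0 _] [g0 _]] := ((gl0_spaceP _).1 (subvsP f), (gl0_spaceP _).1 (subvsP g)).
apply/gl0_spaceP; split; first by rewrite rpredB//; exact: (@gEnd_comp 0 0).
apply/lfunP => v; rewrite !(comp_lfunE, add_lfunE, opp_lfunE) linearB /=.
by rewrite !d_comm.
Qed.
Definition gl0_lie (f g : gl0) : gl0 := Subvs (gl0_lie_subproof f g).

Fact gl_delta_subproof (s : E1) :
  ((d \o vsval s) + (vsval s \o d))%VF \in gl0_space.
Proof.
apply/gl0_spaceP; split.
  rewrite rpredD//; first exact: (gEnd_comp gEnd_d (subvsP s)).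
  exact: (gEnd_comp (subvsP s) gEnd_d).
apply/lfunP => v; rewrite !(comp_lfunE, add_lfunE) linearD /= !dd0.
by rewrite linear0 add0r addr0.
Qed.
Definition gl_delta_pre (s : E1) : gl0 := Subvs (gl_delta_subproof s).

Fact gl_act_subproof (f : gl0) (s : E1) :
  ((vsval f \o vsval s) - (vsval s \o vsval f))%VF \in gEnd (-1).
Proof.
have [f0 _] := (gl0_spaceP _).1 (subvsP f).
rewrite rpredB//; first exact: (@gEnd_comp 0 (-1) _ _ f0 (subvsP s)).
exact: (@gEnd_comp (-1) 0 _ _ (subvsP s) f0).
Qed.
Definition gl_act_pre (f : gl0) (s : E1) : E1 := Subvs (gl_act_subproof f s).

Fact gl1_lie_subproof (s t : E1) :
  ((vsval s \o d \o vsval t) - (vsval t \o d \o vsval s)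
   + (vsval s \o vsval t \o d) - (vsval t \o vsval s \o d))%VF \in gEnd (-1).
Proof.
have [sE tE] := (subvsP s, subvsP t).
rewrite rpredB ?rpredD ?rpredN//.
- exact: (@gEnd_comp 0 (-1) _ _ (@gEnd_comp (-1) 1 _ _ sE gEnd_d) tE).
- exact: (@gEnd_comp 0 (-1) _ _ (@gEnd_comp (-1) 1 _ _ tE gEnd_d) sE).
- exact: (@gEnd_comp (-2) 1 _ _ (@gEnd_comp (-1) (-1) _ _ sE tE) gEnd_d).
- exact: (@gEnd_comp (-2) 1 _ _ (@gEnd_comp (-1) (-1) _ _ tE sE) gEnd_d).
Qed.
Definition gl1_lie_pre (s t : E1) : E1 := Subvs (gl1_lie_subproof s t).

(* The operations on representatives descend to the quotient gl1: see the
   lemmas gl_deltaE, gl_actE and gl1_lieE. *)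
Definition gl_delta (x : gl1) : gl0 := gl_delta_pre (repr x).
Definition gl_act (f : gl0) (x : gl1) : gl1 := gl_pi (gl_act_pre f (repr x)).
Definition gl1_lie (x y : gl1) : gl1 := gl_pi (gl1_lie_pre (repr x) (repr y)).

Let piP (s t : E1) : (exists2 h, h \in gEnd (-2) &
  forall v, vsval s v - vsval t v = d (h v) - h (d v)) -> gl_pi s = gl_pi t.
Proof.
move=> [h hE st]; apply/qprojE/gEnd_exactP; exists h => //.
by apply/lfunP => v; rewrite gcomm2E -st /= add_lfunE opp_lfunE.
Qed.

Let repr_piP (s : E1) : exists2 h, h \in gEnd (-2) &
  forall v, vsval (repr (gl_pi s)) v = vsval s v + (d (h v) - h (d v)).
Proof.
have /gEnd_exactP[h hE e] := qproj_repr gEnd_exact s.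
exists h => // v; rewrite -gcomm2E -e /= add_lfunE opp_lfunE.
by rewrite addrC subrK.
Qed.

Lemma gl_deltaE s : gl_delta (gl_pi s) = gl_delta_pre s.
Proof.
have [h _ e] := repr_piP s; apply/val_inj/lfunP => v /=.
rewrite !(add_lfunE, comp_lfunE) !e !linearD !linearN /= !dd0 linear0.
by rewrite !add0r subr0 addrACA addNr addr0.
Qed.

Lemma gl_actE (f : gl0) s : gl_act f (gl_pi s) = gl_pi (gl_act_pre f s).
Proof.
have [h hE e] := repr_piP s.
have [f0 _] := (gl0_spaceP _).1 (subvsP f).
apply: piP; exists ((vsval f \o h) - (h \o vsval f))%VF.
  rewrite rpredB//; first exact: (@gEnd_comp 0 (-2) _ _ f0 hE).
  exact: (@gEnd_comp (-2) 0 _ _ hE f0).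
move=> v /=; rewrite !(add_lfunE, opp_lfunE, comp_lfunE) !e.
rewrite !linearD !linearN /= !d_comm.
apply: scalar_ext => l.
rewrite ?opprD ?opprK !(linearD, linearN) /=.
by do ![move: (l _) => ?]; ring.
Qed.

Lemma gl_piD s t : gl_pi (s + t) = gl_pi s + gl_pi t.
Proof. exact: linearD. Qed.
Lemma gl_piZ a s : gl_pi (a *: s) = a *: gl_pi s.
Proof. exact: linearZ. Qed.
Lemma gl_piN s : gl_pi (- s) = - gl_pi s.
Proof. exact: linearN. Qed.
Lemma gl_pi_surj x : exists s, x = gl_pi s.
Proof. by exists (repr x); rewrite /gl_pi qproj_surj. Qed.

Lemma gl1_lie_preE s t :
  gl_pi (gl1_lie_pre s t) = gl_pi (gl_act_pre (gl_delta_pre s) t).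
Proof.
apply: piP; exists (- (vsval s \o vsval t))%VF.
  by rewrite rpredN; exact: (@gEnd_comp (-1) (-1) _ _ (subvsP s) (subvsP t)).
move=> v /=; rewrite !(add_lfunE, opp_lfunE, comp_lfunE).
rewrite !linearD !linearN /=.
apply: scalar_ext => l.
rewrite ?opprD ?opprK !(linearD, linearN) /=.
by do ![move: (l _) => ?]; ring.
Qed.

Lemma gl1_peiffer (x y : gl1) : gl1_lie x y = gl_act (gl_delta x) y.
Proof. exact: gl1_lie_preE. Qed.

Lemma gl1_lieE s t : gl1_lie (gl_pi s) (gl_pi t) = gl_pi (gl1_lie_pre s t).
Proof. by rewrite gl1_peiffer gl_deltaE gl_actE gl1_lie_preE. Qed.

Lemma gl_delta_linear : linear gl_delta.
Proof.
move=> a x y; have [[s ->] [t ->]] := (gl_pi_surj x, gl_pi_surj y).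
rewrite -gl_piZ -gl_piD !gl_deltaE; apply/val_inj/lfunP => v /=.
rewrite !(add_lfunE, scale_lfunE, comp_lfunE) /= linearD linearZ /=.
by rewrite scalerDr addrACA.
Qed.

Lemma gl_act_linearr (f : gl0) : linear (gl_act f).
Proof.
move=> a x y; have [[s ->] [t ->]] := (gl_pi_surj x, gl_pi_surj y).
rewrite -gl_piZ -gl_piD !gl_actE -gl_piZ -gl_piD; congr gl_pi.
apply/val_inj/lfunP => v /=.
rewrite !(add_lfunE, opp_lfunE, scale_lfunE, comp_lfunE) /= linearD linearZ /=.
by rewrite scalerBr opprD addrACA.
Qed.

Lemma gl_act_linearl (x : gl1) : linear (gl_act^~ x).
Proof.
move=> a f g; have [s ->] := gl_pi_surj x.
rewrite !gl_actE -gl_piZ -gl_piD; congr gl_pi.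
apply/val_inj/lfunP => v /=.
rewrite !(add_lfunE, opp_lfunE, scale_lfunE, comp_lfunE) /= linearD linearZ /=.
by rewrite scalerBr opprD addrACA.
Qed.

Lemma gl0_lie_linearr (f : gl0) : linear (gl0_lie f).
Proof.
move=> a g h; apply/val_inj/lfunP => v /=.
rewrite !(add_lfunE, opp_lfunE, scale_lfunE, comp_lfunE) /= linearD linearZ /=.
by rewrite scalerBr opprD addrACA.
Qed.

Lemma gl0_lieC (f g : gl0) : gl0_lie f g = - gl0_lie g f.
Proof. by apply/val_inj; rewrite /= opprB. Qed.

Lemma gl0_lie_linearl (g : gl0) : linear (gl0_lie^~ g).
Proof.
move=> a f h.
by rewrite /= gl0_lieC gl0_lie_linearr opprD -scalerN -!gl0_lieC.
Qed.

Lemma gl0_liexx (f : gl0) : gl0_lie f f = 0.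
Proof. by apply/val_inj; rewrite /= subrr. Qed.

Lemma gl0_jacobi (f g h : gl0) :
  gl0_lie f (gl0_lie g h) = gl0_lie (gl0_lie f g) h + gl0_lie g (gl0_lie f h).
Proof.
apply/val_inj/lfunP => v /=.
rewrite !(add_lfunE, opp_lfunE, comp_lfunE) !linearB /=.
apply: scalar_ext => l.
rewrite ?opprD ?opprK !(linearD, linearN) /=.
by do ![move: (l _) => ?]; ring.
Qed.

Lemma gl_act_lie (f g : gl0) x :
  gl_act (gl0_lie f g) x = gl_act f (gl_act g x) - gl_act g (gl_act f x).
Proof.
have [s ->] := gl_pi_surj x.
rewrite !gl_actE -gl_piN -gl_piD; congr gl_pi.
apply/val_inj/lfunP => v /=.
do 5! [rewrite ?add_lfunE ?opp_lfunE ?comp_lfunE].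
rewrite ![vsval f (_ - _)]linearB ![vsval g (_ - _)]linearB.
rewrite ![vsval s (_ - _)]linearB /=.
do ![move: (vsval f _) => ?]; do ![move: (vsval g _) => ?].
do ![move: (vsval s _) => ?].
apply: scalar_ext => l.
rewrite ?opprD ?opprK !(linearD, linearN) /=.
by do ![move: (l _) => ?]; ring.
Qed.

Lemma gl_delta_act (f : gl0) x : gl_delta (gl_act f x) = gl0_lie f (gl_delta x).
Proof.
have [s ->] := gl_pi_surj x.
rewrite gl_actE !gl_deltaE; apply/val_inj/lfunP => v /=.
do 5! [rewrite ?add_lfunE ?opp_lfunE ?comp_lfunE].
rewrite ![d (_ - _)]linearB ![vsval f (_ + _)]linearD /= !d_comm.
do ![move: (vsval f _) => ?]; do ![move: (d _) => ?]; do ![move: (vsval s _) => ?].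
apply: scalar_ext => l.
rewrite ?opprD ?opprK !(linearD, linearN) /=.
by do ![move: (l _) => ?]; ring.
Qed.

Lemma gl_delta_lie x y :
  gl_delta (gl1_lie x y) = gl0_lie (gl_delta x) (gl_delta y).
Proof. by rewrite gl1_peiffer gl_delta_act. Qed.

Lemma gl1_lie_linearr x : linear (gl1_lie x).
Proof. by move=> a y z; rewrite !gl1_peiffer gl_act_linearr. Qed.

Lemma gl1_lie_linearl y : linear (gl1_lie^~ y).
Proof. by move=> a x z; rewrite /= !gl1_peiffer gl_delta_linear gl_act_linearl. Qed.

Lemma gl1_liexx x : gl1_lie x x = 0.
Proof.
have [s ->] := gl_pi_surj x; rewrite gl1_lieE.
rewrite (_ : gl1_lie_pre s s = 0) ?[gl_pi 0]linear0//.
by apply/val_inj; rewrite /= subrr add0r subrr.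
Qed.

Lemma gl1_jacobi x y z :
  gl1_lie x (gl1_lie y z) = gl1_lie (gl1_lie x y) z + gl1_lie y (gl1_lie x z).
Proof. by rewrite !gl1_peiffer gl_delta_act gl_act_lie subrK. Qed.

Lemma gl_act_der (f : gl0) x y :
  gl_act f (gl1_lie x y) = gl1_lie (gl_act f x) y + gl1_lie x (gl_act f y).
Proof. by rewrite !gl1_peiffer gl_delta_act gl_act_lie subrK. Qed.

Definition gl0_lieAlg : lieAlg R := LieAlg
  (conj gl0_lie_linearl gl0_lie_linearr) gl0_liexx gl0_jacobi.

Definition gl1_lieAlg : lieAlg R := LieAlg
  (conj gl1_lie_linearl gl1_lie_linearr) gl1_liexx gl1_jacobi.

Definition gl : lieCrossedModule R := @LieCrossedModule R gl0_lieAlg gl1_lieAlg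
  gl_delta gl_act gl_delta_linear gl_delta_lie
  (conj gl_act_linearl gl_act_linearr) gl_act_lie gl_act_der
  gl_delta_act (fun x y => esym (gl1_peiffer x y)).

End EndV.

Section Smooth.
Context {R : realType}.

(* f is of class C^k on the open set O *)
Fixpoint Ck (n k : nat) (O : set 'rV[R]_n) (f : 'rV[R]_n -> R) : Prop :=
  if k is k'.+1 then
    (forall x, O x -> differentiable f x) /\ forall v, Ck k' O (fun x => 'D_v f x)
  else forall x, O x -> {for x, continuous f}.

(* A map into a finite-dimensional space W is smooth iff its composite with
   every linear form on W is. *)
Definition smooth_on n (W : vectType R) (O : set 'rV[R]_n) (f : 'rV[R]_n -> W) :=
  forall l : {scalar W}, forall k, Ck k O (fun x => l (f x)).

(* The derivative of a map into W, computed in a basis of W *)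
Definition vderive n (W : vectType R) (f : 'rV[R]_n -> W) (v x : 'rV[R]_n) : W :=
  \sum_i 'D_v (fun y => coord (vbasis {:W}) i (f y)) x *: (vbasis {:W})`_i.

(* A chart is a homeomorphism from the open set ch_dom onto an open set of
   R^n; outside of ch_dom (resp. of its image) the values of ch_map (resp.
   ch_inv) are irrelevant. *)
Record chart (T : topologicalType) (n : nat) := Chart {
  ch_dom : set T;
  ch_map :> T -> 'rV[R]_n;
  ch_inv : 'rV[R]_n -> T;
  ch_dom_open : open ch_dom;
  ch_cod_open : open (ch_map @` ch_dom);
  ch_mapK : forall p, ch_dom p -> ch_inv (ch_map p) = p;
  ch_map_cont : forall p, ch_dom p -> {for p, continuous ch_map};
  ch_inv_cont : forall x, (ch_map @` ch_dom) x -> {for x, continuous ch_inv}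
}.

Definition ch_cod T n (c : chart T n) : set 'rV[R]_n := c @` ch_dom c.

Definition transition T n (c c' : chart T n) : 'rV[R]_n -> 'rV[R]_n :=
  c' \o ch_inv c.

End Smooth.
Arguments chart : clear implicits.

Record smoothManifold (R : realType) := SmoothManifold {
  mf_space :> topologicalType;
  mf_hausdorff : hausdorff_space mf_space;
  mf_countable : @second_countable mf_space;
  mf_dim : nat;
  mf_atlas : set (chart R mf_space mf_dim);
  mf_cover : forall p, exists2 c, mf_atlas c & ch_dom c p;
  mf_smooth : forall c c', mf_atlas c -> mf_atlas c' ->
    smooth_on (c @` (ch_dom c `&` ch_dom c')) (transition c c')
}.

Section Forms.
Context {R : realType} (M : smoothManifold R).
Local Notation n := (mf_dim M).
Local Notation chartM := (chart R M n).

(* A W-valued k-form is given by its expressions in the charts: for a chart c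
   and x in ch_cod c, [w c x X] is the value at x of the form on the k tangent
   vectors that are the rows of X. The values for c outside of the atlas or x
   outside of ch_cod c are irrelevant. *)
Definition preform k (W : vectType R) := chartM -> 'rV[R]_n -> 'M[R]_(k, n) -> W.

Definition eqform k (W : vectType R) (w w' : preform k W) :=
  forall c x, mf_atlas c -> ch_cod c x -> w c x = w' c x.

Definition multilinear_rows k (W : vectType R) (f : 'M[R]_(k, n) -> W) :=
  forall (i : 'I_k) (a b : R) (X Y Z : 'M[R]_(k, n)),
    row i X = a *: row i Y + b *: row i Z ->
    row' i Y = row' i X -> row' i Z = row' i X ->
    f X = a *: f Y + b *: f Z.

Definition alternating_rows k (W : vectType R) (f : 'M[R]_(k, n) -> W) :=
  forall (i j : 'I_k) X, i != j -> row i X = row j X -> f X = 0.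

Record diff_form k (W : vectType R) := DiffForm {
  form_val :> preform k W;
  form_multilinear : forall c x, mf_atlas c -> ch_cod c x ->
    multilinear_rows (form_val c x);
  form_alternating : forall c x, mf_atlas c -> ch_cod c x ->
    alternating_rows (form_val c x);
  form_smooth : forall c X, mf_atlas c ->
    smooth_on (ch_cod c) (fun x => form_val c x X);
  form_transition : forall c c' p X, mf_atlas c -> mf_atlas c' ->
    ch_dom c p -> ch_dom c' p ->
    form_val c (c p) X =
    form_val c' (c' p) (X *m jacobian (transition c c') (c p))
}.

Definition ext_d k W (w : preform k W) : preform k.+1 W := fun c x X =>
  \sum_(i < k.+1)
    (-1) ^+ i *: vderive (fun y => w c y (row' i X)) (row i X) x.

(* The wedge product along a bilinear map b, that is
   (w (x) u) /\ (h (x) v) = (w /\ h) (x) b u v *)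
Definition wedge (U W Z : vectType R) (b : U -> W -> Z) p q
    (w : preform p U) (h : preform q W) : preform (p + q) Z := fun c x X =>
  ((p`! * q`!)%:R)^-1 *: \sum_(s : 'S_(p + q))
    (-1) ^+ s *: b (w c x (usubmx (row_perm s X))) (h c x (dsubmx (row_perm s X))).

Definition cast_form p q (W : vectType R) (e : p = q) (w : preform p W) :
  preform q W := fun c x X => w c x (castmx (esym e, erefl n) X).

Definition map_form p (U W : vectType R) (f : U -> W) (w : preform p U) :
  preform p W := fun c x X => f (w c x X).

End Forms.

Section Superconnections.
Context {R : realType} (M : smoothManifold R) (V : cochainComplex R).

(* alpha = alpha^1 + alpha^2 + ..., with alpha^i in Omega^i(M) (x) End^{1-i}(V) *)
Record superconnection := Superconnection {
  sc_form :> forall i : nat, diff_form M i (subvs_of (gEnd V (1 - i%:Z)));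
  sc_form0 : eqform (sc_form 0) (fun _ _ _ => 0)
}.

(* Elements of Omega(M) (x) V, as families of their homogeneous components;
   these vanish in degrees greater than dim M. *)
Definition Vpreform := forall k : nat, preform M k V.

Definition op_partial (P : Vpreform) : Vpreform := fun k =>
  map_form (fun v => (-1) ^+ k *: cc_d V v) (P k).

Definition op_d (P : Vpreform) : Vpreform := fun k =>
  if k is k'.+1 then ext_d (P k') else fun _ _ _ => 0.

Definition op_form (alpha : superconnection) (P : Vpreform) : Vpreform :=
  fun k c x X => \sum_(i < k.+1)
    (-1) ^ ((1 - i%:Z) * (k - i)%:Z) *:
    cast_form (subnKC (ltn_ord i : (i <= k)%N))
      (wedge (fun (f : subvs_of (gEnd V (1 - i%:Z))) v => vsval f v) (alpha i) (P (k - i)%N))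
      c x X.

Arguments op_partial P k : clear implicits.
Arguments op_d P k : clear implicits.
Arguments op_form alpha P k : clear implicits.

Definition op_D (alpha : superconnection) (P : Vpreform) : Vpreform :=
  fun k c x X =>
    op_partial P k c x X + op_d P k c x X + op_form alpha P k c x X.

Arguments op_D alpha P k : clear implicits.

Definition flat_superconnection (alpha : superconnection) :=
  forall P : (forall k : nat, diff_form M k V), forall k,
    eqform (op_D alpha (op_D alpha P) k) (fun _ _ _ => 0).

End Superconnections.

Section Connections.
Context {R : realType} (M : smoothManifold R) (G : lieCrossedModule R).

Record local_2connection := Local2Connection {
  conn_A : diff_form M 1 (cm_g G);
  conn_B : diff_form M 2 (cm_e G);
  conn_fake_flat : eqform (map_form (@cm_delta _ G) conn_B)
    (fun c x X => ext_d conn_A c x X + 2^-1 *: wedge (@lie _ _) conn_A conn_A c x X)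
}.

Definition flat_2connection (T : local_2connection) :=
  eqform (k := 3) (fun c x X =>
    ext_d (conn_B T) c x X + wedge (@cm_act _ G) (conn_A T) (conn_B T) c x X)
  (fun _ _ _ => 0).

End Connections.

(* Main.v *)
(* Flatness is only tested on the constant sections v of Omega(M) (x) V. For
   such a v, D v = partial v + sum_k alpha^k v, and the components of degrees 1,
   2, 3 of D (D v) = 0 are the structure equations: alpha^1 commutes with
   partial, [partial, alpha^2] + d alpha^1 + alpha^1 o alpha^1 = 0, and
   d alpha^2 + alpha^1 /\ alpha^2 - alpha^2 /\ alpha^1 = [partial, alpha^3].
   The first one puts A in gl^0, the second one is fake flatness, and the third
   one is flatness, its right-hand side being killed by pi. *)
Require Import Defs.
From HB Require Import structures.
From mathcomp Require Import all_boot all_order all_algebra.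
From mathcomp Require Import all_classical all_reals all_analysis.
From mathcomp Require Import perm.

Set Implicit Arguments.
Unset Strict Implicit.
Unset Printing Implicit Defensive.

Import GRing.Theory Num.Theory.
Import numFieldNormedType.Exports.
Local Open Scope ring_scope.

(** * Alternating multilinear maps and the signature *)

Section AlternatingForms.
Context {R : realType} {M : smoothManifold R}.
Local Notation n := (mf_dim M).

(** Since alternation means vanishing on repeated rows, polarization gives the sign of a
    transposition. Decomposing [s] into transpositions then gives its signature. *)
Lemma alternating_row_perm p (W : vectType R) (f : 'M[R]_(p, n) -> W)
    (s : 'S_p) (X : 'M[R]_(p, n)) :
  multilinear_rows (M := M) f -> alternating_rows (M := M) f ->
  f (row_perm s X) = (-1) ^+ s *: f X.
Proof.
move=> fL fA.
pose upd (Y : 'M[R]_(p, n)) i (a : 'rV[R]_n) :=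
  \matrix_(k, l) (if k == i then a 0 l else Y k l).
have row_upd Y i a : row i (upd Y i a) = a.
  by apply/rowP => l; rewrite !mxE eqxx.
have row_upd' Y i j a : j != i -> row j (upd Y i a) = row j Y.
  by move=> /negPf ji; apply/rowP => l; rewrite !mxE ji.
have row'_upd Y i a : row' i (upd Y i a) = row' i Y.
  by apply/matrixP => k l; rewrite !mxE eq_sym (negPf (neq_lift _ _)).
have updC Y i j a b : i != j -> upd (upd Y i a) j b = upd (upd Y j b) i a.
  move=> ij; apply/matrixP => k l; rewrite !mxE.
  by case: (eqVneq k j) => [->|//]; rewrite eq_sym (negPf ij).
have updD Y i a b : f (upd Y i (a + b)) = f (upd Y i a) + f (upd Y i b).
  rewrite (fL i 1 1 _ (upd Y i a) (upd Y i b)) ?scale1r//.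
  - by rewrite !row_upd.
  - by rewrite !row'_upd.
  - by rewrite !row'_upd.
have tpermN i j Y : i != j -> f (row_perm (tperm i j) Y) = - f Y.
  move=> ij; set a := row i Y; set b := row j Y.
  have eqab c : f (upd (upd Y i c) j c) = 0.
    by apply: (fA i j) => //; rewrite row_upd row_upd' ?row_upd.
  (* Expanding the zero value with [a + b] in both rows leaves only the two mixed terms: [f Y] and
     [f] of [Y] with rows [i] and [j] exchanged. *)
  have /eqP := eqab (a + b).
  rewrite updD ![upd (upd Y i (a + b)) j _]updC // !updD.
  rewrite -![upd (upd Y j _) i _]updC // !eqab.
  have -> : upd (upd Y i a) j b = Y.
    apply/matrixP => k l; rewrite !mxE.
    by case: eqVneq => [->//|_]; case: eqVneq => [->|].
  have -> : upd (upd Y i b) j a = row_perm (tperm i j) Y.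
    apply/matrixP => k l; rewrite !mxE.
    case: tpermP => [->|->|/eqP/negPf -> /eqP/negPf -> //].
      by rewrite eqxx (negPf ij).
    by rewrite eqxx.
  by rewrite addr0 add0r addr_eq0 => /eqP.
have [ts -> ts_d] := prod_tpermP s.
rewrite odd_perm_prod//; elim: ts ts_d => [|[i j] ts IH] /=.
  by rewrite big_nil row_perm1 scale1r.
move=> /andP[ij /IH {}IH]; rewrite big_cons row_permM tpermN //= {}IH.
by case: (odd _); rewrite /= !(expr0, expr1, scale1r, scaleN1r, opprK).
Qed.

End AlternatingForms.

(** * Derivatives and smoothness of vector-valued maps *)

Section VectorDerivative.
Context {R : realType} {n : nat}.
Implicit Types U W : vectType R.

(** [vderive] is computed in unrelated bases of [U] and [W]. They are compared through the matrix
    [c] of [f], whose constant entries pass through the scalar derivatives. *)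
Lemma vderive_linear U W (f : {linear U -> W}) (w : 'rV[R]_n -> U)
    (v x : 'rV[R]_n) :
  (forall i, derivable (fun y => coord (vbasis {:U}) i (w y)) x v) ->
  vderive (fun y => f (w y)) v x = f (vderive w v x).
Proof.
move=> wD; rewrite /vderive linear_sum /=.
pose c i (j : 'I_(\dim {:U})) : R :=
  coord (vbasis {:W}) i (f (vbasis {:U})`_j).
have fE i : 'D_v (fun y => coord (vbasis {:W}) i (f (w y))) x =
    \sum_j c i j *: 'D_v (fun y => coord (vbasis {:U}) j (w y)) x.
  transitivity
    ('D_v (\sum_j (c i j \*: (fun y => coord (vbasis {:U}) j (w y)))) x).
    congr ('D_v _ x); apply/funext => y; rewrite fct_sumE.
    rewrite {1}(coord_vbasis (memvf (w y))) !linear_sum /=.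
    by apply: eq_bigr => j _; rewrite !linearZ /= mulrC.
  rewrite derive_sum => [|j]; last exact: derivableZ.
  by apply: eq_bigr => j _; rewrite deriveZ.
under eq_bigr do rewrite fE scaler_suml.
rewrite exchange_big /=; apply: eq_bigr => j _.
rewrite linearZ /= [in RHS](coord_vbasis (memvf (f _))) scaler_sumr.
by apply: eq_bigr => i _; rewrite scalerA [_ *: 'D__ _ _]mulrC.
Qed.

Lemma near_eq_vderive W (w w' : 'rV[R]_n -> W) (v x : 'rV[R]_n) :
  (\forall y \near x, w y = w' y) -> vderive w v x = vderive w' v x.
Proof.
move=> ww'; apply: eq_bigr => i _; congr (_ *: _).
by apply: near_eq_derive; apply: filterS ww' => y ->.
Qed.

Lemma vderive_cst W (a : W) (v x : 'rV[R]_n) : vderive (fun=> a) v x = 0.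
Proof. by rewrite /vderive big1 // => i _; rewrite derive_cst scale0r. Qed.

Lemma smooth_on_cst W (O : set 'rV[R]_n) (a : W) : smooth_on O (fun=> a).
Proof.
move=> l k; elim: k (l a) => [|k IH] b /=; first by move=> x _; exact: cst_continuous.
split=> [x _|v]; first exact: differentiable_cst.
have -> : (fun x => 'D_v (fun=> b) x) = fun=> 0.
  by apply/funext => x; exact: derive_cst.
exact: IH.
Qed.

Lemma smooth_on_linear U W (O : set 'rV[R]_n) (f : {linear U -> W})
    (w : 'rV[R]_n -> U) : smooth_on O w -> smooth_on O (fun x => f (w x)).
Proof. by move=> wS l; exact: (wS (l \o f : {scalar U})). Qed.

Lemma smooth_on_derivable W (O : set 'rV[R]_n) (w : 'rV[R]_n -> W)
    (l : {scalar W}) (v x : 'rV[R]_n) :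
  smooth_on O w -> O x -> derivable (fun y => l (w y)) x v.
Proof. by move=> wS Ox; apply/diff_derivable/((wS l 1%N).1 x Ox). Qed.

End VectorDerivative.

(** * Differential forms: exterior derivative, linear images, wedge products *)

Section Forms.
Context {R : realType} {M : smoothManifold R}.
Local Notation n := (mf_dim M).
Implicit Types (U W Z : vectType R) (c : chart R M n).

(** [eqform] only controls the points of [ch_cod c]. This suffices for derivatives because
    [ch_cod c] is open, so the forms agree near [x]. *)
Lemma eq_ext_d k W (w w' : preform M k W) :
  eqform w w' -> eqform (ext_d w) (ext_d w').
Proof.
move=> ww' c x cA cx; apply/funext => X; apply: eq_bigr => i _; congr (_ *: _).
apply: near_eq_vderive.
have : nbhs x (ch_cod c) by apply: open_nbhs_nbhs; split=> //; exact: ch_cod_open.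
by apply: filterS => y cy; rewrite ww'.
Qed.

Lemma ext_d_linear k U W (f : {linear U -> W}) (w : diff_form M k U) :
  eqform (ext_d (map_form f w)) (map_form f (ext_d w)).
Proof.
move=> c x cA cx; apply/funext => X; rewrite /map_form /ext_d linear_sum /=.
apply: eq_bigr => i _; rewrite linearZ /= vderive_linear // => j.
by apply: smooth_on_derivable cx; exact: form_smooth.
Qed.

Fact map_form_multilinear k U W (f : {linear U -> W}) (w : diff_form M k U) c x :
  mf_atlas c -> ch_cod c x -> multilinear_rows (map_form f w c x).
Proof.
move=> cA cx i a b X Y Z XE YX ZX.
by rewrite /map_form (form_multilinear w cA cx XE YX ZX) linearD !linearZ.
Qed.

Fact map_form_alternating k U W (f : {linear U -> W}) (w : diff_form M k U) c x :
  mf_atlas c -> ch_cod c x -> alternating_rows (map_form f w c x).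
Proof.
move=> cA cx i j X ij Xij.
by rewrite /map_form (form_alternating w cA cx ij Xij) linear0.
Qed.

Definition map_diff_form k U W (f : {linear U -> W}) (w : diff_form M k U) :
    diff_form M k W := DiffForm
  (@map_form_multilinear k U W f w) (@map_form_alternating k U W f w)
  (fun c X cA => smooth_on_linear f (form_smooth w X cA))
  (fun c c' p X cA c'A cp c'p =>
     congr1 f (form_transition w X cA c'A cp c'p)).

Fact cst_form_multilinear W (a : W) c x :
  mf_atlas c -> ch_cod c x ->
  multilinear_rows (M := M) (fun _ : 'M[R]_(0, n) => a).
Proof. by move=> _ _ []. Qed.

Fact cst_form_alternating W (a : W) c x :
  mf_atlas c -> ch_cod c x ->
  alternating_rows (M := M) (fun _ : 'M[R]_(0, n) => a).
Proof. by move=> _ _ []. Qed.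

Definition cst_form W (a : W) : diff_form M 0 W := DiffForm
  (@cst_form_multilinear W a) (@cst_form_alternating W a)
  (fun c X cA => smooth_on_cst (ch_cod c) a)
  (fun _ _ _ _ _ _ _ _ => erefl a).

Fact zero_form_multilinear k W c x :
  mf_atlas c -> ch_cod c x ->
  multilinear_rows (M := M) (fun _ : 'M[R]_(k, n) => 0 : W).
Proof. by move=> _ _ i a b *; rewrite !scaler0 addr0. Qed.

Fact zero_form_alternating k W c x :
  mf_atlas c -> ch_cod c x ->
  alternating_rows (M := M) (fun _ : 'M[R]_(k, n) => 0 : W).
Proof. by []. Qed.

Definition zero_form k W : diff_form M k W := DiffForm
  (@zero_form_multilinear k W) (@zero_form_alternating k W)
  (fun c X cA => smooth_on_cst (ch_cod c) 0)
  (fun _ _ _ _ _ _ _ _ => erefl 0).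

Lemma ext_d_cst k W (a : W) c x (X : 'M[R]_(k.+1, n)) :
  ext_d (fun _ _ _ => a : W) c x X = 0.
Proof. by rewrite /ext_d big1 // => i _; rewrite vderive_cst scaler0. Qed.

Lemma cast_form_id k W (e : k = k) (w : preform M k W) c x X :
  cast_form e w c x X = w c x X.
Proof. by rewrite /cast_form castmx_id. Qed.

Section Wedge.
Variables p q : nat.

Lemma wedge_linear U W Z Z' (f : {linear Z -> Z'}) (b : U -> W -> Z)
    (w : preform M p U) (h : preform M q W) c x X :
  f (wedge b w h c x X) = wedge (fun u v => f (b u v)) w h c x X.
Proof.
rewrite /wedge linearZ linear_sum /=; congr (_ *: _).
by apply: eq_bigr => s _; rewrite linearZ.
Qed.

Lemma eq_wedge U U' W W' Z (b : U -> W -> Z) (b' : U' -> W' -> Z)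
    (w : preform M p U) (w' : preform M p U')
    (h : preform M q W) (h' : preform M q W') c x X :
  (forall Y Y', b (w c x Y) (h c x Y') = b' (w' c x Y) (h' c x Y')) ->
  wedge b w h c x X = wedge b' w' h' c x X.
Proof.
by move=> e; congr (_ *: _); apply: eq_bigr => s _; rewrite e.
Qed.

Lemma wedgeB U W Z (b b' : U -> W -> Z)
    (w : preform M p U) (h : preform M q W) c x X :
  wedge (fun u v => b u v - b' u v) w h c x X =
  wedge b w h c x X - wedge b' w h c x X.
Proof.
rewrite /wedge -scalerBr -sumrB; congr (_ *: _).
by apply: eq_bigr => s _; rewrite scalerBr.
Qed.

(** Both sizes are variables so that [e] can be eliminated, which is impossible directly for sizes
    such as [p + q] and [q + p]. *)
Lemma sum_row_perm_cast m m' (e : m = m') W (F : 'M[R]_(m', n) -> W)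
    (X : 'M[R]_(m, n)) :
  \sum_(s : 'S_m') (-1) ^+ s *: F (row_perm s (castmx (e, erefl n) X)) =
  \sum_(s : 'S_m) (-1) ^+ s *: F (castmx (e, erefl n) (row_perm s X)).
Proof. by case: m' / e F => F; apply: eq_bigr => s _; rewrite !castmx_id. Qed.

(* The permutation t is the block transposition exchanging the first p rows
   with the last q ones, so its signature is the Koszul sign (-1)^(pq). *)
Lemma wedge_swap (e : (p + q = q + p)%N) (t : 'S_(p + q)) U W Z
    (b : U -> W -> Z) (w : preform M p U) (h : preform M q W) c x X :
  (forall Y : 'M[R]_(p + q, n),
     usubmx (castmx (e, erefl n) Y) = dsubmx (row_perm t Y)) ->
  (forall Y : 'M[R]_(p + q, n),
     dsubmx (castmx (e, erefl n) Y) = usubmx (row_perm t Y)) ->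
  wedge (fun v u => b u v) h w c x (castmx (e, erefl n) X) =
  (-1) ^+ t *: wedge b w h c x X.
Proof.
move=> tu td; rewrite /wedge mulnC scalerA [in RHS]mulrC -scalerA; congr (_ *: _).
pose F Y := b (w c x (dsubmx Y)) (h c x (usubmx Y)).
rewrite (sum_row_perm_cast e F) /F scaler_sumr.
rewrite [RHS](reindex_inj (mulgI t)) /=; apply: eq_bigr => s _.
by rewrite tu td -!row_permM odd_permM signr_addb scalerA signrMK.
Qed.

End Wedge.

(** Each permutation contributes the same term, its signature appearing once in the wedge and once
    by alternation of [w]. The [p!] equal terms cancel the normalization. The argument [0] of [h] is
    the only matrix without rows. *)
Lemma wedge_deg0 p U W Z (b : U -> W -> Z) (w : diff_form M p U)
    (h : preform M 0 W) c x (X : 'M[R]_(p, n)) :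
  (forall v, linear (b^~ v)) -> mf_atlas c -> ch_cod c x ->
  wedge b w h c x (castmx (esym (addn0 p), erefl n) X) = b (form_val w c x X) (h c x 0).
Proof.
move=> bL cA cx; rewrite /wedge.
pose F (Y : 'M[R]_(p + 0, n)) := b (form_val w c x (usubmx Y)) (h c x 0).
under eq_bigr do rewrite (flatmx0 (dsubmx _)).
rewrite (sum_row_perm_cast (esym (addn0 p)) F) /F.
have uK (Y : 'M[R]_(p, n)) : usubmx (castmx (esym (addn0 p), erefl n) Y) = Y.
  apply/matrixP => i j; rewrite mxE castmxE /= cast_ord_id esymK.
  by congr (Y _ _); apply/val_inj.
have bZ a u v : b (a *: u) v = a *: b u v.
  have b0 : b 0 v = 0.
    have /eqP := bL v 1 0 0.
    by rewrite /= scaler0 addr0 scale1r -subr_eq subrr => /eqP.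
  by have := bL v a u 0; rewrite /= b0 !addr0.
under eq_bigr => s _.
  rewrite uK (alternating_row_perm s X (form_multilinear w cA cx)
    (form_alternating w cA cx)) bZ scalerA -signr_addb addbb scale1r.
  over.
rewrite sumr_const card_Sn fact0 muln1 -[X in _ *: X]scaler_nat scalerA.
by rewrite mulVf ?scale1r.
Qed.

End Forms.

(** * Evaluating endomorphisms at a vector *)

Section Evaluation.
Context {R : realType} {V : cochainComplex R} (U : {vspace 'End(V)}).

(** Being linear, evaluation commutes with [ext_d] and [wedge], so identities between
    endomorphism-valued forms can be checked in [V], whatever subspace the forms take values in. *)
Definition subvs_eval (v : V) (f : subvs_of U) : V := vsval f v.

Fact subvs_eval_linear v : linear (subvs_eval v).
Proof. by move=> a f g; rewrite /subvs_eval /= add_lfunE scale_lfunE. Qed.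

HB.instance Definition _ v := GRing.isLinear.Build R (subvs_of U) V _
  (subvs_eval v) (subvs_eval_linear v).

Definition comp_eval (U' : {vspace 'End(V)}) (v : V) (f : subvs_of U)
  (g : subvs_of U') : V := vsval f (vsval g v).

End Evaluation.

#[local] Arguments op_partial {R M V} P k.
#[local] Arguments op_d {R M V} P k.
#[local] Arguments op_form {R M V} alpha P k.
#[local] Arguments op_D {R M V} alpha P k.

(** * The operator [D] on constant sections *)

Section ConstantSections.
Context {R : realType} {M : smoothManifold R} {V : cochainComplex R}.
Variable alpha : superconnection M V.
Local Notation n := (mf_dim M).
Local Notation d := (cc_d V).
Local Notation app i := (fun (f : subvs_of (gEnd V (1 - i%:Z))) v => vsval f v).
Implicit Types (c : chart R M n) (v : V).

Definition cst_family v k : diff_form M k V :=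
  if k is k'.+1 then zero_form k'.+1 V else cst_form v.

Lemma wedge_degree0 q (P : preform M q V) c x X :
  mf_atlas c -> ch_cod c x -> wedge (app 0%N) (alpha 0) P c x X = 0.
Proof.
move=> cA cx; rewrite /wedge big1 ?scaler0// => s _.
by rewrite sc_form0 //= lfunE /= scaler0.
Qed.

Lemma wedge_cst_family i m v c x X : (0 < m)%N ->
  wedge (app i) (alpha i) (cst_family v m) c x X = 0.
Proof.
case: m X => // m X _; rewrite /wedge big1 ?scaler0// => s _.
by rewrite linear0 scaler0.
Qed.

(** The degree [m] is kept apart from [0] because it is instantiated by [k - k], which does not
    reduce to [0]. *)
Lemma wedge_cst_family0 k m (e : (k + m = k)%N) v c x X : m = 0%N ->
  mf_atlas c -> ch_cod c x ->
  cast_form e (wedge (app k) (alpha k) (cst_family v m)) c x X =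
  vsval (form_val (alpha k) c x X) v.
Proof.
move=> m0 cA cx; subst m; rewrite /cast_form (eq_irrelevance e (addn0 k)).
by rewrite wedge_deg0 // => w a f g; rewrite /= add_lfunE scale_lfunE.
Qed.

(** Only the summand [i = k] meets the degree 0 component of the constant section, and its Koszul
    sign has exponent 0. *)
Lemma op_form_cst k v c x X : mf_atlas c -> ch_cod c x ->
  op_form alpha (cst_family v) k c x X = vsval (form_val (alpha k) c x X) v.
Proof.
move=> cA cx; rewrite /op_form big_ord_recr /= big1 ?add0r => [|i _].
  by rewrite wedge_cst_family0 ?subnn// mulr0 expr0z scale1r.
by rewrite /cast_form wedge_cst_family ?scaler0// subn_gt0.
Qed.

Lemma op_D_cst0 v c x X : mf_atlas c -> ch_cod c x ->
  op_D alpha (cst_family v) 0 c x X = d v.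
Proof.
move=> cA cx; rewrite /op_D op_form_cst // sc_form0 // lfunE /= !addr0.
by rewrite /op_partial /map_form expr0 scale1r.
Qed.

Lemma op_D_cstS k v c x X : mf_atlas c -> ch_cod c x ->
  op_D alpha (cst_family v) k.+1 c x X =
  vsval (form_val (alpha k.+1) c x X) v.
Proof.
move=> cA cx; rewrite /op_D op_form_cst // /op_partial /map_form linear0 scaler0.
rewrite add0r [op_d _ _ _ _ _](_ : _ = 0) ?add0r//.
by case: k X => [|k] X; exact: ext_d_cst.
Qed.

End ConstantSections.

(** * The structure equations in degrees 1, 2 and 3 *)

Section StructureEquations.
Context {R : realType} {M : smoothManifold R} {V : cochainComplex R}.
Variable alpha : superconnection M V.
Hypothesis alpha_flat : flat_superconnection alpha.
Local Notation n := (mf_dim M).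
Local Notation d := (cc_d V).
Local Notation app i := (fun (f : subvs_of (gEnd V (1 - i%:Z))) v => vsval f v).
Local Notation Dcst v := (op_D alpha (cst_family v)).
Implicit Types (c : chart R M n) (v : V).

Lemma ext_d_op_D_cst k v c x X : mf_atlas c -> ch_cod c x ->
  ext_d (Dcst v k.+1) c x X = vsval (ext_d (alpha k.+1) c x X) v.
Proof.
move=> cA cx.
have DE : eqform (Dcst v k.+1) (map_form (subvs_eval v) (alpha k.+1)).
  by move=> c' y c'A c'y; apply/funext => Y; rewrite op_D_cstS.
by rewrite /op_d (eq_ext_d DE) // ext_d_linear.
Qed.

Lemma wedge_op_D_cst0 k (e : (k + 0 = k)%N) v c x X : mf_atlas c -> ch_cod c x ->
  cast_form e (wedge (app k) (alpha k) (Dcst v 0)) c x X =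
  vsval (form_val (alpha k) c x X) (d v).
Proof.
move=> cA cx; rewrite /cast_form (eq_irrelevance e (addn0 k)).
rewrite wedge_deg0 ?op_D_cst0 // => w a f g.
by rewrite /= add_lfunE scale_lfunE.
Qed.

(** The summand [i = 0] vanishes because [alpha] has no component in degree 0. *)
Lemma op_form_recl (P : Vpreform M V) k c x (X : 'M[R]_(k.+1, n)) :
  mf_atlas c -> ch_cod c x ->
  op_form alpha P _ c x X = \sum_(i < k.+1)
    (-1) ^ ((1 - i.+1%:Z) * (k - i)%:Z) *:
    cast_form (subnKC (ltn_ord i : (i.+1 <= k.+1)%N))
      (wedge (app i.+1) (alpha i.+1) (P (k - i)%N)) c x X.
Proof.
move=> cA cx; rewrite /op_form big_ord_recl [X in X + _](_ : _ = 0) ?add0r.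
  apply: eq_bigr => i _; rewrite /cast_form; congr (_ *: wedge _ _ _ _ _ _).
  exact: eq_castmx.
by rewrite /cast_form wedge_degree0 ?scaler0.
Qed.

Lemma op_DE (P : Vpreform M V) k c x X : op_D alpha P k c x X =
  op_partial P k c x X + op_d P k c x X + op_form alpha P k c x X.
Proof. by []. Qed.

Lemma flat_degree1 v c x X : mf_atlas c -> ch_cod c x ->
  d (vsval (form_val (alpha 1) c x X) v) = vsval (form_val (alpha 1) c x X) (d v).
Proof.
move=> cA cx.
have := congr1 (@^~ X) (alpha_flat (cst_family v) 1%N cA cx).
rewrite op_DE.
have -> : op_partial (Dcst v) _ c x X = - d (vsval (form_val (alpha 1) c x X) v).
  by rewrite /op_partial /map_form op_D_cstS // expr1 scaleN1r.
(* The degree 0 component of [D v] is the constant [d v], so its exterior derivative vanishes. *)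
have -> : op_d (Dcst v) 1 c x X = 0.
  have DE : eqform (Dcst v 0) (fun _ _ _ => d v).
    by move=> c' y c'A c'y; apply/funext => Y; rewrite op_D_cst0.
  transitivity (ext_d (fun _ _ _ => d v : V) c x X); last exact: ext_d_cst.
  exact: (congr1 (@^~ X) (eq_ext_d DE cA cx)).
rewrite op_form_recl // big_ord1 /=.
rewrite [cast_form _ _ _ _ _](wedge_op_D_cst0 _ _ _ cA cx) expr0z scale1r addr0.
by rewrite addrC => /eqP; rewrite subr_eq0 => /eqP.
Qed.

(** All signs are positive: [partial] acts on a form of even degree, [alpha 1] has endomorphism
    degree 0, and [alpha 2] acts on a form of degree 0. *)
Lemma flat_degree2 v c x (X : 'M[R]_(2, n)) : mf_atlas c -> ch_cod c x ->
  d (vsval (form_val (alpha 2) c x X) v) +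
    vsval (form_val (alpha 2) c x X) (d v) + vsval (ext_d (alpha 1) c x X) v +
    wedge (comp_eval v) (alpha 1) (alpha 1) c x X = 0.
Proof.
move=> cA cx.
have := congr1 (@^~ X) (alpha_flat (cst_family v) 2%N cA cx).
rewrite op_DE.
have -> : op_partial (Dcst v) _ c x X = d (vsval (form_val (alpha 2) c x X) v).
  by rewrite /op_partial /map_form op_D_cstS // sqrrN expr1n scale1r.
rewrite [op_d _ _ _ _ _]ext_d_op_D_cst // op_form_recl //.
rewrite !big_ord_recl big_ord0 /=.
rewrite [X in _ *: X + (_ + _)](cast_form_id (k := 2)).
rewrite [X in _ + (_ *: X + _)](wedge_op_D_cst0 _ _ _ cA cx).
rewrite !expr0z !scale1r addr0.
rewrite (eq_wedge (b' := comp_eval v)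
  (w' := alpha 1%N) (h' := alpha 1%N)) => [|Y Y']; last first.
  by rewrite (op_D_cstS alpha (k := 0) v Y' cA cx).
by move=> <-; rewrite -!addrA; congr (_ + _); rewrite addrC -addrA.
Qed.

Lemma flat_degree3 v c x (X : 'M[R]_(3, n)) : mf_atlas c -> ch_cod c x ->
  vsval (ext_d (alpha 2) c x X) v +
    (wedge (comp_eval v) (alpha 1) (alpha 2) c x X -
     wedge (comp_eval v) (alpha 2) (alpha 1) c x X) =
  d (vsval (form_val (alpha 3) c x X) v) -
    vsval (form_val (alpha 3) c x X) (d v).
Proof.
move=> cA cx.
have := congr1 (@^~ X) (alpha_flat (cst_family v) 3%N cA cx).
rewrite op_DE.
have -> : op_partial (Dcst v) _ c x X = - d (vsval (form_val (alpha 3) c x X) v).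
  by rewrite /op_partial /map_form op_D_cstS // -signr_odd expr1 scaleN1r.
rewrite [op_d _ _ _ _ _]ext_d_op_D_cst // op_form_recl //.
rewrite !big_ord_recl big_ord0 /=.
rewrite [X in _ *: X + (_ + _)](cast_form_id (k := 3)).
rewrite [X in _ + (_ *: X + _)](cast_form_id (k := 3)).
rewrite [X in _ + (_ + (_ *: X + _))](wedge_op_D_cst0 _ _ _ cA cx).
(* The only negative Koszul sign: [alpha 2], of endomorphism degree -1, moves past the 1-form
   [alpha 1] applied to [v]. *)
rewrite [X in _ + (X *: _ + _)](etrans (exprN1 (-1)) (invrN1 R)) scaleN1r.
rewrite !expr0z !scale1r addr0.
rewrite [X in _ + (X + _) = 0](eq_wedge (b' := comp_eval v)
  (w' := alpha 1%N) (h' := alpha 2%N)) => [|Y Y']; last first.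
  by rewrite (op_D_cstS alpha (k := 1) v Y' cA cx).
rewrite [X in _ + (_ + (- X + _)) = 0](eq_wedge (b' := comp_eval v)
  (w' := alpha 2%N) (h' := alpha 1%N)) => [|Y Y']; last first.
  by rewrite (op_D_cstS alpha (k := 0) v Y' cA cx).
move=> e; apply/eqP; rewrite -subr_eq0 -e; apply/eqP.
by rewrite opprB addrC -!addrA [LHS]addrC -!addrA.
Qed.

End StructureEquations.

(** * The 2-connection of a flat superconnection *)

Section TwoConnection.
Context {R : realType} {M : smoothManifold R} {V : cochainComplex R}.
Local Notation n := (mf_dim M).
Local Notation d := (cc_d V).
Implicit Types (c : chart R M n) (v : V).

Lemma wedge_swap11 (U Z : vectType R) (b : U -> U -> Z) (w : preform M 1 U) c x X :
  wedge (fun u u' => b u' u) w w c x X = - wedge b w w c x X.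
Proof.
pose t : 'S_(1 + 1) := tperm (lshift 1 ord0) (rshift 1 ord0).
have -> : - wedge b w w c x X = (-1) ^+ t *: wedge b w w c x X.
  by rewrite odd_tperm expr1 scaleN1r.
rewrite -(wedge_swap (e := erefl (1 + 1)%N)) ?castmx_id // => Y;
  rewrite castmx_id; apply/matrixP => i j; rewrite !mxE (ord1 i).
  by rewrite tpermR.
by rewrite tpermL.
Qed.

Lemma wedge_swap12 (U W Z : vectType R) (b : U -> W -> Z)
    (w : preform M 1 U) (h : preform M 2 W) c x (X : 'M[R]_(3, n)) :
  wedge (fun u' u => b u u') h w c x X = wedge b w h c x X.
Proof.
pose o1 : 'I_3 := lift ord0 ord0.
(* Moving one row past two others is a 3-cycle, a product of two transpositions, hence even. *)
pose t : 'S_(1 + 2) := (tperm (ord0 : 'I_3) ord_max * tperm ord0 o1)%g.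
have -> : wedge b w h c x X = (-1) ^+ t *: wedge b w h c x X.
  by rewrite odd_permM !odd_tperm scale1r.
rewrite -(wedge_swap (e := erefl (1 + 2)%N)) ?castmx_id // => Y;
  rewrite castmx_id; apply/matrixP => i j; rewrite !mxE permM.
  congr (Y _ _); case: i => [[|[|//]] i2]; rewrite !permE /=; exact/val_inj.
congr (Y _ _); rewrite (ord1 i) !permE /=; exact/val_inj.
Qed.

Definition neg_gl_pi (s : subvs_of (gEnd V (-1))) : cm_e (gl V) := - gl_pi s.

Lemma gl_act_preE (f : subvs_of (gl0_space V)) (s : subvs_of (gEnd V (-1))) v :
  vsval (gl_act_pre f s) v = vsval f (vsval s v) - vsval s (vsval f v).
Proof. by rewrite /= add_lfunE opp_lfunE !comp_lfunE. Qed.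

Lemma neg_gl_piE s : neg_gl_pi s = gl_pi (- s).
Proof. exact/esym/gl_piN. Qed.

Fact neg_gl_pi_linear : linear neg_gl_pi.
Proof.
by move=> a s t; rewrite /neg_gl_pi gl_piD gl_piZ opprD scalerN.
Qed.

HB.instance Definition _ := GRing.isLinear.Build R (subvs_of (gEnd V (-1)))
  (cm_e (gl V)) _ neg_gl_pi neg_gl_pi_linear.

(** The values of [alpha 1] are cochain maps only by flatness, and only at points of charts. A
    linear projection defined on all of [gEnd V 0] makes [A] a smooth form at once; [formAE] shows
    that it leaves these values unchanged. *)
Definition gl0_proj (f : subvs_of (gEnd V 0)) : cm_g (gl V) :=
  vsproj (gl0_space V) (vsval f).

Fact gl0_proj_linear : linear gl0_proj.
Proof. by move=> a f g; rewrite /gl0_proj !linearP. Qed.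

HB.instance Definition _ := GRing.isLinear.Build R (subvs_of (gEnd V 0))
  (cm_g (gl V)) _ gl0_proj gl0_proj_linear.

Variable alpha : superconnection M V.
Hypothesis alpha_flat : flat_superconnection alpha.

Definition formA : diff_form M 1 (cm_g (gl V)) :=
  map_diff_form gl0_proj (alpha 1%N).
Definition formB : diff_form M 2 (cm_e (gl V)) :=
  map_diff_form neg_gl_pi (alpha 2%N).

Lemma formAE c x X : mf_atlas c -> ch_cod c x ->
  vsval (form_val formA c x X : subvs_of (gl0_space V)) =
  vsval (form_val (alpha 1) c x X).
Proof.
move=> cA cx; apply: vsprojK; apply/gl0_spaceP; split; first exact: subvsP.
by apply/lfunP => v; rewrite !comp_lfunE flat_degree1.
Qed.

(** The two exterior derivatives are computed in bases of different spaces. Evaluation at [v] moves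
    both to [V], where the forms agree on the chart by [formAE]. *)
Lemma ext_d_formA v c x X : mf_atlas c -> ch_cod c x ->
  vsval (ext_d formA c x X : subvs_of (gl0_space V)) v =
  vsval (ext_d (alpha 1) c x X) v.
Proof.
move=> cA cx.
have AE : eqform (map_form (subvs_eval v) formA)
                 (map_form (subvs_eval v) (alpha 1%N)).
  by move=> c' y c'A c'y; apply/funext => Y; rewrite /map_form /subvs_eval formAE.
pose A : diff_form M 1 (subvs_of (gl0_space V)) := formA.
have dA := congr1 (@^~ X) (ext_d_linear (subvs_eval v) A cA cx).
have da := congr1 (@^~ X) (ext_d_linear (subvs_eval v) (alpha 1%N) cA cx).
exact: etrans (esym dA) (etrans (congr1 (@^~ X) (eq_ext_d AE cA cx)) da).
Qed.

Lemma formB_fake_flat : eqform (map_form (@cm_delta _ (gl V)) formB)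
  (fun c x X => ext_d formA c x X + 2^-1 *: wedge (@lie _ _) formA formA c x X).
Proof.
move=> c x cA cx; apply/funext => X.
pose s := form_val (alpha 2%N) c x X.
pose e : subvs_of (gl0_space V) := ext_d formA c x X.
pose w : subvs_of (gl0_space V) := wedge (@lie _ _) formA formA c x X.
have eE v : vsval e v = vsval (ext_d (alpha 1) c x X) v by exact: ext_d_formA.
have wE v : vsval w v = 2 *: wedge (comp_eval v) (alpha 1) (alpha 1) c x X.
  transitivity (wedge (fun f g : subvs_of (gl0_space V) =>
      subvs_eval v (gl0_lie f g)) formA formA c x X).
    exact: (@wedge_linear R M 1 1 _ _ _ _ (subvs_eval v) (@gl0_lie R V)).
  (* The second term of the commutator is the first with its factors exchanged. For 1-forms the
     exchange costs a sign, so the terms add up and give the factor 2 that cancels [2^-1]. *)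
  rewrite (eq_wedge (w' := alpha 1%N) (h' := alpha 1%N)
    (b' := fun f g => comp_eval v f g - comp_eval v g f)); last first.
    move=> Y Y'; rewrite /subvs_eval /= add_lfunE opp_lfunE !comp_lfunE.
    by rewrite !formAE.
  by rewrite wedgeB (wedge_swap11 (comp_eval v)) opprK -mulr2n scaler_nat.
(* The value of [B] is the class of [- s], so [delta] can be computed on this representative. What
   remains is [flat_degree2]. *)
suff dsE : gl_delta_pre (- s) = e + 2^-1 *: w.
  exact: etrans (etrans (congr1 _ (neg_gl_piE s)) (gl_deltaE _)) dsE.
clearbody e w; apply/val_inj/lfunP => v /=.
rewrite !(add_lfunE, scale_lfunE, comp_lfunE) !opp_lfunE linearN /= eE wE.
rewrite scalerA mulVf ?pnatr_eq0// scale1r.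
apply/eqP; rewrite -opprD eq_sym -addr_eq0 addrC addrA.
by rewrite flat_degree2.
Qed.

Definition truncation : local_2connection M (gl V) :=
  Local2Connection formB_fake_flat.

Lemma truncation_flat : flat_2connection truncation.
Proof.
move=> c x cA cx; apply/funext => X.
rewrite [ext_d _ _ _ _](congr1 (@^~ X) (ext_d_linear neg_gl_pi (alpha 2%N) cA cx)).
(* The action descends to the quotient, so [neg_gl_pi] can be pulled out of the wedge. The curvature
   becomes the image under [neg_gl_pi] of one form with values in [gEnd V (-1)]. *)
rewrite (eq_wedge (w' := formA) (h' := alpha 2%N)
  (b' := fun f s => neg_gl_pi (gl_act_pre f s))); last first.
  by move=> Y Y'; rewrite /= /map_form /neg_gl_pi -gl_piN gl_actE -gl_piN;
     congr gl_pi; apply/val_inj; rewrite /= comp_lfunNr comp_lfunNl opprB opprK addrC.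
rewrite -(wedge_linear neg_gl_pi) -linearD.
set e := ext_d _ _ _ _; set w := wedge _ _ _ _ _ _.
suff ew0 : gl_pi (e + w) = gl_pi 0.
  apply: etrans (linear0 neg_gl_pi).
  exact: (congr1 (fun t : cm_e (gl V) => - t) ew0).
have wE v : vsval w v = wedge (comp_eval v) (alpha 1) (alpha 2) c x X -
    wedge (comp_eval v) (alpha 2) (alpha 1) c x X.
  rewrite -[LHS]/(subvs_eval v w) wedge_linear.
  (* Putting the 1-form first in the second product costs no sign, so both products form one wedge
     along the commutator. *)
  rewrite (wedge_swap12 (fun f s => comp_eval v s f)) -wedgeB.
  apply: eq_wedge => Y Y'.
  by rewrite /comp_eval -formAE //; exact: gl_act_preE.
(* The value of [alpha 3] has degree [1 - 3 = -2], and by [flat_degree3] its graded commutator with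
   [d] is [e + w]. *)
apply/qprojE/gEnd_exactP; exists (vsval (form_val (alpha 3) c x X)).
  exact: subvsP.
apply/lfunP => v; rewrite gcomm2E -(flat_degree3 alpha_flat) // -wE subr0.
exact: add_lfunE.
Qed.

End TwoConnection.

Theorem lemma4p2 (R : realType) (M : smoothManifold R) (V : cochainComplex R)
    (alpha : superconnection M V) (alpha_flat : flat_superconnection alpha) :
  exists T : local_2connection M (gl V),
    [/\ eqform (map_form (fun phi : subvs_of (gl0_space V) => vsval phi) (conn_A T))
               (map_form (fun phi : subvs_of (gEnd V 0) => vsval phi) (alpha 1%N)),
        eqform (conn_B T) (map_form (fun s => - gl_pi s) (alpha 2%N)) &
        flat_2connection T].
Proof.
exists (truncation alpha_flat); split=> //; last exact: truncation_flat.
by move=> c x cA cx; apply/funext => X; exact: formAE.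
Qed.
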